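(* Let $n\ge3$ and let $X=F\ell_{1,n-1;n}\subset\mathbb{P}^{n-1}\times\mathbb{P}^{n-1}$ be the hypersurface $x_2x_{\hat 2}=x_1x_{\hat 1}+\sum_{j=3}^n(-1)^{j-1}x_jx_{\hat j}$. Put $B_j:=\sum_{k=j}^n(-1)^{k-j}x_kx_{\hat k}$ for $j=3,\dots,n$ (and write $B_j$ also for the corresponding function $\sum_{k=j}^n(-1)^{k-j}A_k$ on the open subset $x_1\ne0$, $x_{\hat n}\ne0$). Then for any $3\le j\le n$, $$\iota_{V_1}\cdots\iota_{V_{n-1}}\Omega_X^{(j)}=(-1)^{n-j}\,d\log\frac{x_1x_{\hat 1}}{B_j}\wedge d\log\frac{x_3x_{\hat 3}}{B_j}\wedge\cdots\wedge d\log\frac{x_{j-1}x_{\widehat{j-1}}}{B_j}\wedge d\log\frac{B_{j+1}}{B_j}\wedge\cdots\wedge d\log\frac{B_n}{B_j},$$ where $$\Omega_X^{(j)}:=\frac{\Omega}{A_1A_3\cdots A_{j-1}B_j\cdots B_n}.$$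
   Context: On the open subset $x_1\ne0$, $x_{\hat n}\ne0$ of $X$, put $z_i=x_i/x_1$, $z_{\hat i}=x_{\hat i}/x_{\hat n}$ (so $z_1=z_{\hat n}=1$). Then $(z_2,\dots,z_n,z_{\hat2},\dots,z_{\widehat{n-1}})$ are local coordinates on $X$. Put $A_i=z_iz_{\hat i}$ for $i=1,\dots,n$, so that on $X$ one has $A_2=A_1+\sum_{i=3}^n(-1)^{i-1}A_i$, and $$\Omega:=dz_2dz_{\hat2}\cdots dz_{n-1}dz_{\widehat{n-1}}dz_n$$ (wedge products). The torus $T=\{(t_1,\dots,t_n)\in(S^1)^n\mid t_1\cdots t_n=1\}$ acts by $x_i\mapsto t_ix_i$, $x_{\hat i}\mapsto(\prod_{l\neq i}t_l)x_{\hat i}$. With $\theta_k$ the weight of $t_k$ and $\psi_i=\theta_{i+1}-\theta_1$ ($1\le i\le n-1$), the coordinate $z_{i+1}$ has weight $\psi_i$ and $z_{\hat k}$ has weight $\psi_{n-1}-\psi_{k-1}$ ($2\le k\le n-1$). $V_i$ is the vector field corresponding to $\psi_i$, with the convention $\iota_{V_i}=\sum_yc_y\,y\,\iota_{\partial_y}$, where $y$ runs over the coordinates, $c_y$ is the coefficient of $\psi_i$ in the weight of $y$, and $\iota_{\partial_y}$ is contraction (on the left) with the holomorphic vector field $\partial/\partial y$. Explicitly, $V_{i-1}=z_i\partial_{z_i}-z_{\hat i}\partial_{z_{\hat i}}$ for $2\le i\le n-1$, and $V_{n-1}=z_n\partial_{z_n}+\sum_{i=2}^{n-1}z_{\hat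 i}\partial_{z_{\hat i}}$. *)

(* Defs.v *)
From HB Require Import structures.
From mathcomp Require Import all_boot all_order all_algebra.
From mathcomp Require Import all_classical all_reals all_analysis.
From mathcomp Require Import ring.
From mathcomp Require Export complex.
Set Implicit Arguments.
Unset Strict Implicit.
Unset Printing Implicit Defensive.
Import Order.TTheory GRing.Theory Num.Theory.
Import numFieldNormedType.Exports.
Local Open Scope ring_scope.

(* Differential forms on a normed space V over K.  The value of a k-form at a *)
(* point is an alternating k-linear function of tangent vectors; the vectors  *)
(* are given as a list, and a k-form vanishes on lists of length other than k.*)
Section Forms.
Context {K : numFieldType} {V : normedModType K}.

Definition dform := V -> seq V -> K.

Definition form1 : dform := fun _ vs => (nilp vs)%:R.

Definition scalef (f : V -> K) (w : dform) : dform :=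
  fun p vs => f p * w p vs.

(* Number of pairs i < k with m_i = false and m_k = true: the number of       *)
(* inversions of the shuffle listing first the true, then the false positions.*)
Fixpoint inversions (m : bitseq) : nat :=
  if m is b :: m' then (~~ b * count id m' + inversions m')%N else 0%N.

(* The shuffle formula, with no factorials:                                   *)
(* (dx /\ dy)(v, w) = dx(v) dy(w) - dx(w) dy(v).                              *)
Definition wedge (a b : dform) : dform := fun p vs =>
  \sum_(m : (size vs).-tuple bool)
     (-1) ^+ inversions m * (a p (mask m vs) * b p (mask (map negb m) vs)).

Definition wedges (s : seq dform) : dform := foldr wedge form1 s.

Definition ext_d (f : V -> K) : dform := fun p vs =>
  if vs is [:: v] then 'd f p v else 0.

Definition dlog (f : V -> K) : dform := scalef (fun p => (f p)^-1) (ext_d f).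

Definition contract (X : V -> V) (w : dform) : dform :=
  fun p vs => w p (X p :: vs).

End Forms.

Arguments dform {K} V.

(* Homogeneous coordinates x_1, ..., x_n, x_^1, ..., x_^n are indexed by nat; *)
(* values outside 1, ..., n are irrelevant.                                   *)
Section Flag.
Context {K : fieldType} (n : nat).
Implicit Types x xh : nat -> K.

Definition on_X x xh : Prop :=
  x 2 * xh 2 =
  x 1 * xh 1 + \sum_(3 <= j < n.+1) (-1) ^+ (j - 1) * (x j * xh j).

Definition homB (j : nat) x xh : K :=
  \sum_(j <= k < n.+1) (-1) ^+ (k - j) * (x k * xh k).

Definition torus_x (t : nat -> K) x i := t i * x i.
Definition torus_xh (t : nat -> K) xh i :=
  (\prod_(1 <= l < n.+1 | l != i) t l) * xh i.

End Flag.

(* The point with coordinates (z_2, ..., z_n) and (z_^2, ..., z_^(n-1)); the  *)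
(* entry k (counted from 0) of either row is the coordinate of index k + 2.   *)
Definition chart (K : numFieldType) (n : nat) : normedModType K :=
  ('rV[K]_(n - 1) * 'rV[K]_(n - 2))%type.

Section Chart.
Context {K : numFieldType} (n : nat).
Implicit Types (p : chart K n) (x xh t : nat -> K).

Definition entry m (u : 'rV[K]_m) (k : nat) : K := oapp (u 0) 0 (insub k).

Definition z (i : nat) p : K := if i == 1%N then 1 else entry p.1 (i - 2).

(* z_^1 is not a coordinate: it is determined by the equation of X. *)
Definition zhat (i : nat) p : K :=
  let zh k := if k == n then 1 else entry p.2 (k - 2) in
  if i == 1%N then
    z 2 p * zh 2 - \sum_(3 <= k < n.+1) (-1) ^+ (k - 1) * (z k p * zh k)
  else zh i.

Definition A (i : nat) p : K := z i p * zhat i p.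

Definition B (j : nat) p : K :=
  \sum_(j <= k < n.+1) (-1) ^+ (k - j) * A k p.

Definition Omega : dform (chart K n) :=
  wedges (flatten [seq [:: ext_d (z i); ext_d (zhat i)] | i <- index_iota 2 n]
          ++ [:: ext_d (z n)]).

(* A weight is given by its coefficients on psi_1, ..., psi_(n-1),           *)
(* where psi_i = theta_(i+1) - theta_1.                                       *)
Definition psi (i : nat) : nat -> int := fun l => (l == i)%:Z.
Definition weight_z (i : nat) : nat -> int := psi (i - 1).
Definition weight_zhat (i : nat) : nat -> int :=
  fun l => psi (n - 1) l - psi (i - 1) l.

(* V_i = sum over the coordinates y of c_y y d/dy. *)
Definition V (i : nat) (p : chart K n) : chart K n :=
  (\row_(k < n - 1) ((weight_z (k + 2) i)%:~R * p.1 0 k),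
   \row_(k < n - 2) ((weight_zhat (k + 2) i)%:~R * p.2 0 k)).

(* iota_(V_1) ... iota_(V_(n-1)) w: the contraction with V_(n-1) comes first. *)
Definition contract_all (w : dform (chart K n)) : dform (chart K n) :=
  foldr (fun i => contract (V i)) w (index_iota 1 n).

Definition OmegaX (j : nat) : dform (chart K n) :=
  scalef (fun p => (A 1 p * (\prod_(3 <= i < j) A i p)
                          * (\prod_(j <= k < n.+1) B k p))^-1) Omega.

Definition regular_at (j : nat) p : Prop :=
  [/\ A 1 p != 0,
      forall i, (3 <= i < j)%N -> A i p != 0
    & forall k, (j <= k <= n)%N -> B k p != 0].

(* The function x_i x_^i / B_j on X is A_i / B_j on the chart, see ratioAB.   *)
Definition dlog_form (j : nat) : dform (chart K n) :=
  wedges (dlog (fun p => A 1 p / B j p)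
          :: [seq dlog (fun p => A i p / B j p) | i <- index_iota 3 j]
          ++ [seq dlog (fun p => B k p / B j p) | k <- index_iota j.+1 n.+1]).

(* Meaningful on the open subset x_1 <> 0, x_^n <> 0 of X only. *)
Definition local_coords x xh : chart K n :=
  (\row_k (x (k + 2)%N / x 1%N), \row_k (xh (k + 2)%N / xh n)).

Lemma entryE m (u : 'rV[K]_m) (i : 'I_m) : entry u i = u 0 i.
Proof. by rewrite /entry valK. Qed.

Lemma entry_row m (f : nat -> K) k : (k < m)%N ->
  entry (\row_(i < m) f i) k = f k.
Proof. by move=> km; rewrite -[k]/(val (Ordinal km)) entryE mxE. Qed.

Lemma chart_on_X p : (2 <= n)%N -> on_X n (z^~ p) (zhat^~ p).
Proof.
move=> n2; rewrite /on_X /zhat /=.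
rewrite {3}/z /= mul1r.
rewrite [X in _ = _ + X](eq_big_nat _ _ (F2 := fun k : nat => (-1) ^+ (k - 1) *
  (z k p * (if k == n then 1 else entry p.2 (k - 2))))); last first.
  by move=> [|[|k]].
by rewrite subrK.
Qed.

Section Homogeneous.
Variables x xh : nat -> K.
Hypotheses (n3 : (3 <= n)%N) (x1 : x 1%N != 0) (xhn : xh n != 0).

Lemma z_local i : (1 <= i <= n)%N -> z i (local_coords x xh) = x i / x 1%N.
Proof.
move=> /andP[i1 ilen]; rewrite /z; case: eqP => [->|/eqP ni]; first by rewrite divff.
have i2 : (2 <= i)%N by rewrite ltn_neqAle eq_sym ni.
rewrite (entry_row (fun k => x (k + 2)%N / x 1%N)) ?subnK //.
by rewrite ltn_subLR // addnBA ?(ltnW (ltnW n3)) // addnC addn2 subn1.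
Qed.

Let zhE k : (2 <= k <= n)%N ->
  (if k == n then 1 else entry (local_coords x xh).2 (k - 2)) = xh k / xh n.
Proof.
move=> /andP[k2 kn]; case: eqP => [->|/eqP nk]; first by rewrite divff.
rewrite (entry_row (fun k => xh (k + 2)%N / xh n)) ?subnK //.
by rewrite ltn_sub2r // ?ltn_neqAle ?nk.
Qed.

Lemma zhat_local_ge2 i : (2 <= i <= n)%N ->
  zhat i (local_coords x xh) = xh i / xh n.
Proof.
move=> hi; rewrite /zhat; case: eqVneq hi => [->//|_] hi.
exact: zhE.
Qed.

Lemma zhat_local i : on_X n x xh -> (1 <= i <= n)%N ->
  zhat i (local_coords x xh) = xh i / xh n.
Proof.
move=> xX /andP[i1 ilen]; case: (eqVneq i 1%N) => [->|ni]; last first.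
  by rewrite zhat_local_ge2 // ilen andbT ltn_neqAle eq_sym ni.
rewrite /zhat /=.
rewrite zhE ?z_local ?(ltnW n3) //.
under eq_big_nat => k /andP[k3 kn].
  rewrite zhE ?(ltnW k3) // z_local ?(ltnW (ltnW k3)) //.
  have -> : (-1) ^+ (k - 1) * (x k / x 1%N * (xh k / xh n)) =
            (-1) ^+ (k - 1) * (x k * xh k) * (x 1%N * xh n)^-1.
    by rewrite invfM; ring.
  over.
rewrite -mulr_suml.
have -> : \sum_(3 <= k < n.+1) (-1) ^+ (k - 1) * (x k * xh k) =
          x 2%N * xh 2%N - x 1%N * xh 1%N 
  by rewrite xX addrAC subrr add0r.
by field; rewrite x1 xhn.
Qed.

Lemma A_local i : on_X n x xh -> (1 <= i <= n)%N ->
  A i (local_coords x xh) = x i * xh i / (x 1%N * xh n).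
Proof.
by move=> xX hi; rewrite /A z_local // zhat_local // mulf_div.
Qed.

Lemma B_local j : on_X n x xh -> (1 <= j)%N ->
  B j (local_coords x xh) = homB n j x xh / (x 1%N * xh n).
Proof.
move=> xX j1; rewrite /B /homB mulr_suml; apply: eq_big_nat => k /andP[jk kn].
by rewrite A_local ?(leq_trans j1) // mulrA.
Qed.

Lemma ratioAB i j : on_X n x xh -> (1 <= i <= n)%N -> (1 <= j)%N ->
  A i (local_coords x xh) / B j (local_coords x xh) =
  x i * xh i / homB n j x xh.
Proof.
move=> xX hi j1; rewrite A_local // B_local // invf_div mulrA divfK //.
by rewrite mulf_neq0.
Qed.

Lemma ratioBB k j : on_X n x xh -> (1 <= k)%N -> (1 <= j)%N ->
  B k (local_coords x xh) / B j (local_coords x xh) =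
  homB n k x xh / homB n j x xh.
Proof.
move=> xX hk j1; rewrite !B_local // invf_div mulrA divfK //.
by rewrite mulf_neq0.
Qed.

End Homogeneous.

(* The character of the torus with weight \sum_l c_l psi_l. *)
Definition character (c : nat -> int) t : K :=
  \prod_(1 <= l < n) (t l.+1 / t 1%N) ^ c l.

Lemma character_psi t i : (1 <= i < n)%N ->
  character (psi i) t = t i.+1 / t 1%N.
Proof.
move=> hi; rewrite /character (bigD1_seq i) ?mem_index_iota ?iota_uniq //=.
rewrite /psi eqxx expr1z big1 ?mulr1 // => l /negPf il.
by rewrite il expr0z.
Qed.

Section Torus.
Variables t x xh : nat -> K.
Hypotheses (n3 : (3 <= n)%N) (x1 : x 1%N != 0) (xhn : xh n != 0).
Hypothesis t0 : forall i, (1 <= i <= n)%N -> t i != 0.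

Let tt0 i : \prod_(1 <= l < n.+1 | l != i) t l != 0.
Proof.
rewrite big_seq_cond prodf_seq_neq0; apply/allP => l _; apply/implyP.
by rewrite mem_index_iota ltnS => /andP[/t0].
Qed.

Let t1 : t 1%N != 0. Proof. by apply: t0; rewrite (leq_trans _ n3). Qed.
Let tn : t n != 0. Proof. by apply: t0; rewrite leqnn (leq_trans _ n3). Qed.

Lemma torus_z i : (2 <= i <= n)%N ->
  z i (local_coords (torus_x t x) (torus_xh n t xh)) =
  character (weight_z i) t * z i (local_coords x xh).
Proof.
move=> /andP[i2 ilen]; have i1 := ltnW i2.
have hi : (1 <= i - 1 < n)%N.
  by rewrite subn_gt0 i2 (leq_trans _ ilen) // subn1 ltn_predL.
rewrite /weight_z character_psi // !z_local ?i1 ?mulf_neq0 //.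
by rewrite subn1 prednK // /torus_x mulf_div.
Qed.

Lemma torus_zhat i : (2 <= i < n)%N ->
  zhat i (local_coords (torus_x t x) (torus_xh n t xh)) =
  character (weight_zhat i) t * zhat i (local_coords x xh).
Proof.
move=> /andP[i2 iltn]; have ilen := ltnW iltn; have i1 := ltnW i2.
have ti : t i != 0 by rewrite t0 // i1.
have hi : (1 <= i - 1 < n)%N.
  by rewrite subn_gt0 i2 (leq_trans _ ilen) // subn1 ltn_predL.
have hn : (1 <= n - 1 < n)%N.
  by rewrite subn_gt0 (ltnW n3) subn1 ltn_predL (leq_trans _ n3).
have -> : character (weight_zhat i) t =
          character (psi (n - 1)) t / character (psi (i - 1)) t.
  rewrite /character -prodf_div; apply: eq_big_nat => l /andP[l1 ln].
  by rewrite expfzDr ?invr_expz // mulf_neq0 ?invr_eq0 // t0.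
rewrite !character_psi // !zhat_local_ge2 ?i2 ?ilen ?mulf_neq0 // /torus_xh.
have tprod k : (1 <= k <= n)%N ->
  \prod_(1 <= l < n.+1 | l != k) t l = (\prod_(1 <= l < n.+1) t l) / t k.
  move=> hk; rewrite [in RHS](bigD1_seq k) ?mem_index_iota ?iota_uniq //=.
  by rewrite mulrC mulKf ?t0.
have P0 : \prod_(1 <= l < n.+1) t l != 0.
  rewrite big_seq prodf_seq_neq0; apply/allP => l _; apply/implyP.
  by rewrite mem_index_iota ltnS => /t0.
have n1 : (1 <= n)%N := leq_trans i1 ilen.
rewrite !tprod ?i1 ?n1 ?ilen ?leqnn // !subn1 !prednK //.
by field; rewrite ti tn t1 xhn P0.
Qed.

End Torus.

End Chart.

(* Main.v *)
(* Write A_i = z_i z_^i.  Contraction with V_(i-1) turns dz_i /\ dz_^i into   *)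

(* The identity is pointwise, so it is proved in the exterior algebra at the single point [p]:
   [wedges_form1E] turns the wedge products into iterated products [ewedges] of differentials at
   [p], and [foldr_contractE] turns contraction with fields into insertion of vectors. Three
   algebraic lemmas then carry the argument. [iprods_flag] contracts the pairs to dA_2, ..., dA_n;
   [ewedges_AB] is a unitriangular change of coframe; [iprod_ewedges_AB] inserts the Euler field.

   The sign has two sources. V_(n-1) is contracted first but used last, and moving it past the other
   n - 2 fields costs (-1)^(n-2). In the new coframe dB_j stands behind the j - 2 factors dA_1,
   dA_3, ..., dA_(j-1), and bringing it to the front costs (-1)^(j-2). Together they give
   (-1)^(n-j). *)
(* dA_i and kills all other factors, so V_1, ..., V_(n-2) reduce Omega to     *)
(*   dA_2 /\ ... /\ dA_n                                                      *)
(*     = dA_1 /\ dA_3 /\ ... /\ dA_(j-1) /\ dB_j /\ ... /\ dB_n,              *)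
(* on which V_(n-1) acts as the Euler field: dA_i(V_(n-1)) = A_i.  Division   *)
(* by A_1 A_3 ... B_n leaves the contraction of a product of dlog's, each of  *)
(* which takes the value 1 on V_(n-1); moving dlog B_j to the front and       *)
(* subtracting it from the other factors gives the claim.  No step divides by *)
(* z_i or z_^i, which may vanish at the point.                                *)
Require Import Defs.
From HB Require Import structures.
From mathcomp Require Import all_boot all_order all_algebra.
From mathcomp Require Import all_classical all_reals all_analysis.
From mathcomp Require Import ring zify.
Import Order.TTheory GRing.Theory Num.Theory.
Import numFieldNormedType.Exports.
Local Open Scope ring_scope.

(** * Products of 1-forms and contractions at a point *)

Section ExteriorAlgebra.
Set Implicit Arguments.
Unset Strict Implicit.
Context {K : comNzRingType} {V : Type}.
Implicit Types (a b : V -> K) (w : seq V -> K) (u v : V) (vs us : seq V).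
Implicit Types (s t : seq (V -> K)).

Definition iprod v w : seq V -> K := fun vs => w (v :: vs).

(** Taking the Leibniz rule for contraction as the definition of the product of a 1-form with a form
    makes the basic identities inductions on the list of vectors, with [w] generalized. *)
Fixpoint ewedge a w vs : K :=
  if vs is v :: vs' then a v * w vs' - ewedge a (iprod v w) vs' else 0.

Definition ewedges s : seq V -> K :=
  foldr ewedge (fun vs => (nilp vs)%:R) s.

Lemma iprod_ewedge v a w :
  iprod v (ewedge a w) = fun vs => a v * w vs - ewedge a (iprod v w) vs.
Proof. by []. Qed.

Lemma ewedge_linearl c a b w vs :
  ewedge (fun v => a v + c * b v) w vs = ewedge a w vs + c * ewedge b w vs.
Proof.
elim: vs w => [|v vs IH] w /=; first by rewrite mulr0 addr0.
by rewrite IH; ring.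
Qed.

Lemma ewedge_linearr c a w w' vs :
  ewedge a (fun us => w us + c * w' us) vs = ewedge a w vs + c * ewedge a w' vs.
Proof.
elim: vs w w' => [|v vs IH] w w' /=; first by rewrite mulr0 addr0.
by rewrite (IH (iprod v w) (iprod v w')); ring.
Qed.

Lemma ewedge0l w : ewedge (fun=> 0) w = fun=> 0.
Proof.
apply: funext => vs; elim: vs w => [//|v vs IH] w /=.
by rewrite IH mul0r subr0.
Qed.

Lemma ewedge0r a : ewedge a (fun=> 0) = fun=> 0.
Proof.
apply: funext; elim=> [//|v vs IH] /=.
by rewrite [iprod _ _](_ : _ = fun=> 0) // IH mulr0 subr0.
Qed.

Lemma ewedgeZl c a w vs : ewedge (fun v => c * a v) w vs = c * ewedge a w vs.
Proof.
have := ewedge_linearl c (fun=> 0) a w vs; rewrite ewedge0l add0r => <-.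
by congr (ewedge _ w vs); apply: funext => v; rewrite add0r.
Qed.

Lemma ewedgeZr c a w vs :
  ewedge a (fun us => c * w us) vs = c * ewedge a w vs.
Proof.
have := ewedge_linearr c a (fun=> 0) w vs; rewrite ewedge0r add0r => <-.
by congr (ewedge a _ vs); apply: funext => us; rewrite add0r.
Qed.

Lemma ewedgeNr a w vs : ewedge a (fun us => - w us) vs = - ewedge a w vs.
Proof.
rewrite -mulN1r -ewedgeZr.
by congr (ewedge a _ vs); apply: funext => us; rewrite mulN1r.
Qed.

Lemma ewedge_sum0 (I : Type) (r : seq I) (P : pred I) (c : I -> K)
    (a : I -> V -> K) w :
    (forall i, P i -> ewedge (a i) w = fun=> 0) ->
  ewedge (fun v => \sum_(i <- r | P i) c i * a i v) w = fun=> 0.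
Proof.
move=> a0; apply: funext => vs; elim: r => [|i r IH].
  rewrite (_ : (fun v => _) = fun=> 0) ?ewedge0l //.
  by apply: funext => v; rewrite big_nil.
case Pi: (P i).
  rewrite (_ : (fun v => _) =
    fun v => (\sum_(j <- r | P j) c j * a j v) + c i * a i v).
    by rewrite ewedge_linearl IH a0 // mulr0 addr0.
  by apply: funext => v; rewrite big_cons Pi addrC.
rewrite -[RHS]IH; congr (ewedge _ w vs); apply: funext => v.
by rewrite big_cons Pi.
Qed.

(** The Leibniz rule applied twice: contraction passes a pair of 1-forms without a sign. This drives
    the inductions for anticommutation, for squares and for the pairs dz_i, dz_^i. *)
Lemma iprod_ewedge2 v a b w vs :
  ewedge a (ewedge b w) (v :: vs) =
  a v * ewedge b w vs - b v * ewedge a w vs +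
  ewedge a (ewedge b (iprod v w)) vs.
Proof.
rewrite /= iprod_ewedge.
have := ewedge_linearr (-1) a (fun us => b v * w us) (ewedge b (iprod v w)) vs.
rewrite ewedgeZr => E.
rewrite (_ : (fun _ => _) =
  fun us => b v * w us + -1 * ewedge b (iprod v w) us).
  by rewrite E; ring.
by apply: funext => us; ring.
Qed.

Lemma ewedgeNC a b w vs : ewedge a (ewedge b w) vs = - ewedge b (ewedge a w) vs.
Proof.
elim: vs w => [|v vs IH] w; first by rewrite /= oppr0.
by rewrite !iprod_ewedge2 IH; ring.
Qed.

Lemma ewedge_id a w : ewedge a (ewedge a w) = fun=> 0.
Proof.
apply: funext => vs; elim: vs w => [|v vs IH] w //.
by rewrite !iprod_ewedge2 IH; ring.
Qed.

Lemma ewedges_cat s t : ewedges (s ++ t) = foldr ewedge (ewedges t) s.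
Proof. exact: foldr_cat. Qed.

Lemma ewedges_move a s t vs :
  ewedges (s ++ a :: t) vs = (-1) ^+ size s * ewedges (a :: s ++ t) vs.
Proof.
elim: s vs => [|b s IH] vs /=; first by rewrite mul1r.
by rewrite (funext IH) ewedgeZr /= ewedgeNC exprS; ring.
Qed.

(* Membership is expressed by a splitting as V -> K has no decidable equality. *)
Lemma ewedges_dup a s t : ewedge a (ewedges (s ++ a :: t)) = fun=> 0.
Proof.
apply: funext => vs; rewrite (funext (ewedges_move a s t)) ewedgeZr /=.
by rewrite ewedge_id mulr0.
Qed.

Lemma ewedges_dup_map (I : eqType) (f : I -> V -> K) (r : seq I) i t :
  i \in r -> ewedge (f i) (ewedges (map f r ++ t)) = fun=> 0.
Proof.
by case/splitPr => r1 r2; rewrite map_cat /= -catA /= ewedges_dup.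
Qed.

Lemma ewedge_addl a b w : ewedge b w = (fun=> 0) ->
  forall c, ewedge (fun v => a v + c * b v) w = ewedge a w.
Proof.
by move=> bw0 c; apply: funext => vs; rewrite ewedge_linearl bw0 mulr0 addr0.
Qed.

(** Once a difference [b - a] is swapped in front of [a], its part [- a] meets the factor [a] and
    drops out by [ewedge_id]. *)
Lemma ewedges_sub a s vs :
  ewedges (a :: [seq (fun v => b v - a v) | b <- s]) vs = ewedges (a :: s) vs.
Proof.
elim: s vs => [//|b s IH] vs.
transitivity (- ewedge (fun v => b v - a v) (ewedges (a :: s)) vs).
  by rewrite [LHS]ewedgeNC -(funext IH).
rewrite [RHS]ewedgeNC /=; congr (- _).
rewrite -[in RHS](@ewedge_addl b a _ _ (-1)).
  by congr (ewedge _ _ vs); apply: funext => v; rewrite mulN1r.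
exact: ewedge_id.
Qed.

Lemma ewedges_scale (I : Type) (r : seq I) (c : I -> K) (f : I -> V -> K) t vs :
  ewedges ([seq (fun v => c i * f i v) | i <- r] ++ t) vs =
  (\prod_(i <- r) c i) * ewedges (map f r ++ t) vs.
Proof.
elim: r vs => [|i r IH] vs /=; first by rewrite big_nil mul1r.
by rewrite (funext IH) ewedgeZl ewedgeZr big_cons mulrA.
Qed.

Lemma iprod_ewedges_map0 v (I : eqType) (f : I -> V -> K) (r : seq I) t :
    {in r, forall i, f i v = 0} -> iprod v (ewedges t) = (fun=> 0) ->
  iprod v (ewedges (map f r ++ t)) = fun=> 0.
Proof.
move=> f0 t0; elim: r f0 => [//|i r IH] f0.
rewrite /= iprod_ewedge f0 ?mem_head // IH; last first.
  by move=> k kr; apply: f0; rewrite in_cons kr orbT.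
by apply: funext => vs; rewrite ewedge0r mul0r subr0.
Qed.

Definition iprods us w := foldr iprod w us.

Lemma iprodsE us w vs : iprods us w vs = w (rev us ++ vs).
Proof.
elim: us vs => [//|u us IH] vs; rewrite /= /iprod IH.
by rewrite rev_cons cat_rcons.
Qed.

Definition alternating w := forall us u v vs,
  w (us ++ u :: v :: vs) = - w (us ++ v :: u :: vs).

Lemma alternating_ewedge a w : alternating w -> alternating (ewedge a w).
Proof.
move=> altw us u v vs; elim: us w altw => [|x us IH] w altw.
  have -> : ewedge a w [:: u, v & vs] = a u * w (v :: vs) -
      (a v * w (u :: vs) - ewedge a (fun us => w [:: u, v & us]) vs) by [].
  rewrite (_ : (fun us => _) = fun us => - w (v :: u :: us)).
    by rewrite ewedgeNr /= /iprod; ring.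
  by apply: funext => us; exact: (altw [::]).
rewrite !cat_cons /= altw IH; first by ring.
by move=> us' u' v' vs'; exact: (altw (x :: us')).
Qed.

Lemma alternating_ewedges s : alternating (ewedges s).
Proof.
elim: s => [|a s IH]; last exact: alternating_ewedge.
by move=> [|x us] u v vs; rewrite /= ?oppr0.
Qed.

(** The innermost contraction puts [u] first in the list of arguments; alternation moves it behind
    the vectors of [us], one sign for each. This postpones the Euler field V_(n-1) until the pairs
    have been contracted. *)
Lemma iprods_rcons us u w vs : alternating w ->
  iprods (rcons us u) w vs = (-1) ^+ size us * iprods us w (u :: vs).
Proof.
move=> altw; rewrite !iprodsE rev_rcons -size_rev /=.
elim: (rev us) w altw vs => [|x xs IH] w altw vs; first by rewrite mul1r.
rewrite /= (altw [::]) /=.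
have -> : w [:: x, u & xs ++ vs] = iprod x w (u :: xs ++ vs) by [].
rewrite IH; first by rewrite exprS mulN1r mulNr.
by move=> us' u' v' vs'; exact: (altw (x :: us')).
Qed.

Lemma iprods_ewedge2 (I : eqType) (X : I -> V) (r : seq I) a b w :
    {in r, forall i, a (X i) = 0} -> {in r, forall i, b (X i) = 0} ->
  iprods (map X r) (ewedge a (ewedge b w)) =
  ewedge a (ewedge b (iprods (map X r) w)).
Proof.
elim: r => [//|i r IH] a0 b0; rewrite /= IH.
- apply: funext => vs; rewrite /iprod iprod_ewedge2.
  by rewrite a0 ?b0 ?mem_head // !mul0r subr0 add0r.
- by move=> k kr; apply: a0; rewrite in_cons kr orbT.
- by move=> k kr; apply: b0; rewrite in_cons kr orbT.
Qed.

(* Each contraction turns its own pair x_i /\ y_i into a 1-form; that 1-form  *)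
(* is killed by every X_k, so the later contractions do not see it.           *)
Lemma iprods_pairs (I : eqType) (X : I -> V) (x y : I -> V -> K)
    (r : seq I) t :
    uniq r ->
    {in r &, forall i k, i != k -> x i (X k) = 0 /\ y i (X k) = 0} ->
    {in r, forall i, iprod (X i) (ewedges t) = fun=> 0} ->
  iprods (map X r) (ewedges (flatten [seq [:: x i; y i] | i <- r] ++ t)) =
  ewedges
    ([seq (fun v => x i (X i) * y i v - y i (X i) * x i v) | i <- r] ++ t).
Proof.
elim: r => [//|i r IH] /= /andP[ir ur] xy0 t0.
have xy0' : {in r &, forall k l, k != l -> x k (X l) = 0 /\ y k (X l) = 0}.
  by move=> k l kr lr; apply: xy0; rewrite in_cons ?kr ?lr orbT.
have xyi k : k \in r -> x i (X k) = 0 /\ y i (X k) = 0.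
  move=> kr; apply: xy0; rewrite ?mem_head ?in_cons ?kr ?orbT //.
  by apply: contraNneq ir => ->.
have xyk k : k \in r -> x k (X i) = 0 /\ y k (X i) = 0.
  move=> kr; apply: xy0; rewrite ?mem_head ?in_cons ?kr ?orbT //.
  by apply: contraNneq ir => <-.
rewrite iprods_ewedge2; [|by move=> k /xyi[]..].
rewrite IH //; last by move=> k kr; apply: t0; rewrite in_cons kr orbT.
apply: funext => vs; rewrite /iprod iprod_ewedge2 iprod_ewedges_map0.
- rewrite !ewedge0r addr0.
  have := ewedge_linearl (- y i (X i)) (fun v => x i (X i) * y i v) (x i)
    (ewedges
      ([seq (fun v => x i (X i) * y i v - y i (X i) * x i v) | i <- r] ++ t)) vs.
  rewrite ewedgeZl mulNr => <-.
  by congr (ewedge _ _ vs); apply: funext => v; rewrite mulNr.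
- by move=> k /xyk[-> ->]; rewrite !mulr0 subr0.
- by apply: t0; rewrite mem_head.
Qed.

End ExteriorAlgebra.

(** * The changes of coframe and the contractions specific to the flag variety *)

Section Coframes.
Set Implicit Arguments.
Unset Strict Implicit.
Context {V : Type}.

(** The change from [a] to [b] is unitriangular. By induction the tail is already written in [b];
    the first factor is a_j = b_j + b_(j+1), and b_(j+1) is killed because it heads the tail, or is
    zero when the tail is empty. *)
Lemma ewedges_alternating_sums (K : comNzRingType) (a b : nat -> V -> K) j m :
    (forall k v, (j <= k < j + m)%N -> b k v = a k v - b k.+1 v) ->
    (forall v, b (j + m)%N v = 0) ->
  ewedges (map a (iota j m)) = ewedges (map b (iota j m)).
Proof.
elim: m j => [//|m IH] j ba b0 /=.
rewrite IH; last 2 first.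
- by move=> k v /andP[jk km]; apply: ba; rewrite (ltnW jk) addnS.
- by move=> v; rewrite addSn -addnS.
have b1 : ewedge (b j.+1) (ewedges (map b (iota j.+1 m))) = fun=> 0.
  case: m {IH ba} b0 => [|m] b0 /=; last by rewrite ewedge_id.
  rewrite (_ : b j.+1 = fun=> 0) ?ewedge0l //.
  by apply: funext => v; rewrite -(b0 v) addn1.
rewrite -(ewedge_addl (b j) b1 1); congr (ewedge _ _).
by apply: funext => v; rewrite ba ?leqnn ?addnS ?ltnS ?leq_addr // mul1r subrK.
Qed.

(* Divided by the product of the values c_i = f_i(E) and b = h(E), the left   *)
(* side is the contraction with E of the wedge product of the f_i / c_i and   *)
(* h / b.  In that product h / b, which takes the value 1 at E, may be        *)
(* subtracted from all other factors, and these differences vanish at E.      *)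
Lemma iprod_ewedges_ratio (K : fieldType) (I : eqType) (f : I -> V -> K)
    (c : I -> K) (r1 r2 : seq I) (h : V -> K) (b : K) E vs :
    {in r1 ++ r2, forall i, c i != 0} -> b != 0 ->
    {in r1 ++ r2, forall i, f i E = c i} -> h E = b ->
  ewedges (map f r1 ++ h :: map f r2) (E :: vs) =
  (-1) ^+ size r1 * (b * \prod_(i <- r1 ++ r2) c i) *
  ewedges [seq (fun v => (c i)^-1 * f i v - b^-1 * h v) | i <- r1 ++ r2] vs.
Proof.
set r := r1 ++ r2 => c0 b0 fE hE.
rewrite ewedges_move size_map -map_cat -/r -!mulrA; congr (_ * _).
rewrite -[LHS]/(ewedge h (ewedges (map f r)) (E :: vs)).
pose f' i v := (c i)^-1 * f i v; pose h' v := b^-1 * h v.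
have -> : map f r = [seq (fun v => c i * f' i v) | i <- r].
  by apply/eq_in_map => i ir; apply: funext => v; rewrite mulVKf ?c0.
have hh' : h = fun v => b * h' v by apply: funext => v; rewrite mulVKf.
have -> : ewedges [seq (fun v => c i * f' i v) | i <- r] =
    fun vs => (\prod_(i <- r) c i) * ewedges (map f' r) vs.
  by apply: funext => us; have := ewedges_scale r c f' [::] us; rewrite !cats0.
rewrite [X in ewedge X]hh' ewedgeZl ewedgeZr; congr (_ * (_ * _)).
rewrite -[LHS]/(ewedges (h' :: map f' r) (E :: vs)) -ewedges_sub -map_comp /=.
rewrite (_ : h' E = 1) ?mul1r; last by rewrite /h' hE mulVf.
have := @iprod_ewedges_map0 _ _ E _ (fun i v => f' i v - h' v) r [::].
rewrite cats0 => -> //; first by rewrite ewedge0r subr0.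
by move=> i ir; rewrite /f' /h' fE // hE !mulVf ?c0 // subrr.
Qed.

Lemma map_flatten_pairs (I S S' : Type) (F : S -> S')
    (x y : I -> S) (r : seq I) u :
  map F (flatten [seq [:: x i; y i] | i <- r] ++ [:: u]) =
  flatten [seq [:: F (x i); F (y i)] | i <- r] ++ [:: F u].
Proof. by rewrite map_cat map_flatten -map_comp. Qed.

Lemma map_cons_cat (I S S' : Type) (F : S -> S') u
    (x y : I -> S) (r1 r2 : seq I) :
  map F (u :: [seq x i | i <- r1] ++ [seq y i | i <- r2]) =
  F u :: [seq F (x i) | i <- r1] ++ [seq F (y i) | i <- r2].
Proof. by rewrite /= map_cat -!map_comp. Qed.

(* In the next three lemmas x_i, y_i, a_i and b_k stand for dz_i, dz_^i, dA_i *)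
(* and dB_k at a point, and cx_i, cy_i, ca_i, cb_k for z_i, z_^i, A_i, B_k.   *)
Lemma iprods_flag (K : comNzRingType) n (x y a : nat -> V -> K) (X : nat -> V)
    (cx cy : nat -> K) :
    (3 <= n)%N ->
    (forall l i, (2 <= i <= n)%N -> x i (X l) = (l == i.-1)%:R * cx i) ->
    (forall l i, (2 <= i < n)%N ->
       y i (X l) = ((l == n.-1)%:R - (l == i.-1)%:R) * cy i) ->
    (forall i v, (2 <= i < n)%N -> a i v = cx i * y i v + cy i * x i v) ->
    a n = x n ->
  iprods [seq X l | l <- index_iota 1 n.-1]
    (ewedges (flatten [seq [:: x i; y i] | i <- index_iota 2 n] ++ [:: x n])) =
  ewedges [seq a i | i <- index_iota 2 n.+1].
Proof.
move=> n_ge3 xX yX aE an.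
(* Indexing the fields by i = l + 1 matches V_(i-1) with the pair dz_i, dz_^i. *)
have -> : index_iota 1 n.-1 = map predn (index_iota 2 n).
  rewrite /index_iota (iotaDl 1 1) -map_comp map_id_in; last by [].
  by congr iota; lia.
rewrite -map_comp iprods_pairs ?iota_uniq //.
- have -> : index_iota 2 n.+1 = index_iota 2 n ++ [:: n].
    rewrite /index_iota (_ : n.+1 - 2 = n - 2 + 1)%N; last by lia.
    by rewrite iotaD subnKC ?(ltnW n_ge3).
  rewrite map_cat /= an; congr (ewedges (_ ++ _)).
  apply/eq_in_map => i; rewrite mem_index_iota => hi; apply: funext => v /=.
  have [i2 ltin] := andP hi; rewrite aE // xX ?i2 ?(ltnW ltin) // yX // eqxx.
  by rewrite ltn_eqF /=; [ring | lia].
- move=> i k; rewrite !mem_index_iota => hi hk ik /=; have [i2 ltin] := andP hi.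
  rewrite xX ?i2 ?(ltnW ltin) // yX //.
  have -> : (k.-1 == i.-1) = false by lia.
  have -> : (k.-1 == n.-1) = false by lia.
  by rewrite subrr !mul0r.
- move=> i; rewrite mem_index_iota => hi /=; have [i2 ltin] := andP hi.
  apply: (@iprod_ewedges_map0 _ _ _ _ x [:: n] [::]) => // k.
  rewrite inE => /eqP->; rewrite xX ?leqnn ?(ltnW n_ge3) //.
  by rewrite ltn_eqF ?mul0r //; lia.
Qed.

(** By the equation of X, a_1 differs from a_2 by a combination of a_3, ..., a_n, all of which are
    factors of the product, so a_1 may replace a_2. The factors from index j on are exchanged by
    [ewedges_alternating_sums]. *)
Lemma ewedges_AB (K : comNzRingType) n j (a b : nat -> V -> K) :
    (3 <= j <= n)%N ->
    (forall v, a 1%N v =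
       a 2 v - \sum_(3 <= k < n.+1) (-1) ^+ (k - 1) * a k v) ->
    (forall k v, (3 <= k)%N ->
       b k v = \sum_(k <= i < n.+1) (-1) ^+ (i - k) * a i v) ->
  ewedges [seq a i | i <- index_iota 2 n.+1] =
  ewedges ([seq a i | i <- 1%N :: index_iota 3 j] ++
           [seq b k | k <- index_iota j n.+1]).
Proof.
case/andP=> j3 lejn a1E bE.
have ab : ewedges [seq a i | i <- index_iota j n.+1] =
    ewedges [seq b i | i <- index_iota j n.+1].
  apply: ewedges_alternating_sums => [k v /andP[jk]|v].
    rewrite subnKC ?(leqW lejn) // => kn; have k3 := leq_trans j3 jk.
    rewrite !bE ?(leqW k3) // big_ltn // subnn mul1r; congr (_ + _).
    rewrite -sumrN; apply: eq_big_nat => i /andP[ki _].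
    by rewrite -(subnSK ki) exprS; ring.
  by rewrite subnKC ?(leqW lejn) // bE ?big_geq // (leq_trans j3) ?leqW.
rewrite map_cons cat_cons (_ : index_iota 2 n.+1 = 2%N :: index_iota 3 n.+1);
  last by rewrite /index_iota subSn // (leq_trans (ltnW j3)).
rewrite -[LHS]/(ewedge (a 2) (ewedges _)) -[RHS]/(ewedge (a 1%N) (ewedges _)).
rewrite ewedges_cat -ab -ewedges_cat -map_cat.
have -> : index_iota 3 j ++ index_iota j n.+1 = index_iota 3 n.+1.
  by rewrite /index_iota -{2}(subnKC j3) -iotaD; congr iota; lia.
set w := ewedges _.
(* The membership condition in the sum hands the range of [k] to [ewedge_sum0]; [big_seq] removes it
   afterwards. *)
have w0 : ewedge (fun v => \sum_(k <- index_iota 3 n.+1 |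
    k \in index_iota 3 n.+1) (-1) ^+ (k - 1) * a k v) w = fun=> 0.
  apply: ewedge_sum0 => i ir.
  by have := ewedges_dup_map a [::] ir; rewrite cats0.
rewrite -(ewedge_addl _ w0 (-1)); congr (ewedge _ w); apply: funext => v.
by rewrite a1E mulN1r -big_seq.
Qed.

Lemma iprod_ewedges_AB (K : fieldType) n j (a b : nat -> V -> K)
    (ca cb : nat -> K) E vs :
    (3 <= j <= n)%N ->
    ca 1%N != 0 -> (forall i, (3 <= i < j)%N -> ca i != 0) ->
    (forall k, (j <= k <= n)%N -> cb k != 0) ->
    a 1%N E = ca 1%N -> (forall i, (3 <= i < j)%N -> a i E = ca i) ->
    (forall k, (j <= k <= n)%N -> b k E = cb k) ->
  ewedges ([seq a i | i <- 1%N :: index_iota 3 j] ++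
           [seq b k | k <- index_iota j n.+1]) (E :: vs) =
  (-1) ^+ j *
  (ca 1%N * \prod_(3 <= i < j) ca i * \prod_(j <= k < n.+1) cb k) *
  ewedges (
    (fun v => (ca 1%N)^-1 * a 1%N v - (cb j)^-1 * b j v) ::
    [seq (fun v => (ca i)^-1 * a i v - (cb j)^-1 * b j v)
      | i <- index_iota 3 j] ++
    [seq (fun v => (cb k)^-1 * b k v - (cb j)^-1 * b j v)
      | k <- index_iota j.+1 n.+1]) vs.
Proof.
move=> /andP[j3 lejn] ca1 ca0 cb0 a1E aE bE.
pose r1 := 1%N :: index_iota 3 j; pose r2 := index_iota j.+1 n.+1.
(* Gluing at j merges both families into one indexed by [r1 ++ r2], which omits the pivot j
   itself. *)
pose g i := if (i < j)%N then a i else b i.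
pose cg i := if (i < j)%N then ca i else cb i.
have ltr1 i : i \in r1 -> (i < j)%N.
  by rewrite in_cons mem_index_iota; lia.
have ltr2 i : i \in r2 -> (i < j)%N = false.
  by rewrite mem_index_iota; lia.
have cg0 : {in r1 ++ r2, forall i, cg i != 0}.
  move=> i; rewrite mem_cat /cg => /orP[ir|ir].
    rewrite ltr1 //; move: ir; rewrite in_cons mem_index_iota.
    by case/orP=> [/eqP->|/ca0].
  by rewrite ltr2 //; apply: cb0; move: ir; rewrite mem_index_iota; lia.
have gE : {in r1 ++ r2, forall i, g i E = cg i}.
  move=> i; rewrite mem_cat /cg /g => /orP[ir|ir].
    rewrite ltr1 //; move: ir; rewrite in_cons mem_index_iota.
    by case/orP=> [/eqP->|/aE].
  by rewrite ltr2 //; apply: bE; move: ir; rewrite mem_index_iota; lia.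
have jj : (j <= j <= n)%N by rewrite leqnn.
rewrite (_ : index_iota j n.+1 = j :: r2); last first.
  by rewrite /r2 /index_iota subSn.
rewrite (_ : [seq a i | i <- _] = map g r1); last first.
  by apply/eq_in_map => i ir; rewrite /g ltr1.
rewrite (_ : [seq b k | k <- _] = b j :: map g r2); last first.
  by rewrite map_cons; congr cons; apply/eq_in_map => i ir; rewrite /g ltr2.
rewrite (iprod_ewedges_ratio vs cg0 (cb0 j jj) gE (bE j jj)).
congr (_ * ewedges _ vs); last first.
  rewrite map_cat /=; congr (_ :: _ ++ _).
  - by rewrite /g /cg ltr1 ?mem_head.
  - by apply/eq_in_map => i ir; rewrite /g /cg ltr1 // in_cons ir orbT.
  - by apply/eq_in_map => i ir; rewrite /g /cg ltr2.
congr (_ * _).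
  (* The j - 2 factors in front of b_j give (-1)^(j-2) = (-1)^j. *)
  rewrite /= size_iota (_ : (j - 3).+1 = j - 2)%N; last by lia.
  by rewrite -[in RHS](subnK (ltnW j3)) exprD sqrrN expr1n mulr1.
rewrite big_cat !big_cons /= {1}/cg ltr1 ?mem_head //.
have -> : \prod_(i <- index_iota 3 j) cg i = \prod_(3 <= i < j) ca i.
  by apply: eq_big_seq => i ir; rewrite /cg ltr1 // in_cons ir orbT.
have -> : \prod_(i <- r2) cg i = \prod_(k <- r2) cb k.
  by apply: eq_big_seq => i ir; rewrite /cg ltr2.
by ring.
Qed.

End Coframes.

(** * From the shuffle formula to the recursive product *)

Section WedgeForms.
Set Implicit Arguments.
Unset Strict Implicit.
Context {K : numFieldType} {V : normedModType K}.

Lemma sum_tuple_bool_recl (n : nat) (F : bitseq -> K) :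
  \sum_(m : n.+1.-tuple bool) F m =
  \sum_(m : n.-tuple bool) F (true :: m) +
  \sum_(m : n.-tuple bool) F (false :: m).
Proof.
rewrite (reindex (fun bm : bool * n.-tuple bool => [tuple of bm.1 :: bm.2])) /=.
  rewrite -(pair_bigA _ (fun b (m : n.-tuple bool) => F (b :: m))) /=.
  by rewrite big_bool.
exists (fun m => (thead m, [tuple of behead m])) => [[b m]|m] _ /=.
  by congr pair; apply: val_inj.
by rewrite [in RHS](tuple_eta m); apply: val_inj.
Qed.

(** Split the shuffles by their first bit. If it is true, [a] takes the first vector and all others
    go to [b]; if it is false, [b] takes it, at the cost of one inversion with the single vector
    given to [a]. This is the recursion of [ewedge]. *)
Lemma wedge_form1E (a b : dform V) (l : V -> K) p vs :
    (forall us, a p us = if us is [:: v] then l v else 0) ->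
  wedge a b p vs = ewedge l (b p) vs.
Proof.
move=> al; rewrite /wedge; elim: vs b => [|v vs IH] b /=.
  by rewrite big1 // => m _; rewrite [m]tuple0 /= al mul0r mulr0.
rewrite (sum_tuple_bool_recl _ (fun m => (-1) ^+ inversions m *
  (a p (mask m (v :: vs)) * b p (mask (map negb m) (v :: vs))))) /=.
congr (_ + _).
  (* With its one slot filled, [a] vanishes unless the remaining mask is all false. *)
  rewrite (bigD1 [tuple of nseq (size vs) false]) //= map_nseq mask_true //.
  rewrite mask_false al [inversions _](_ : _ = 0%N) ?add0n ?mul1r.
    rewrite big1 ?addr0 // => m mF; rewrite al.
    case E: (mask m vs) => [|u us]; last by rewrite mul0r mulr0.
    case/eqP: mF; apply: val_inj => /=.
    have : count id m = 0%N by rewrite -(size_mask (s := vs)) ?size_tuple ?E.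
    move=> cm; rewrite -[X in nseq X](size_tuple m); apply/all_pred1P.
    have : ~~ has id m by rewrite has_count cm.
    by rewrite -all_predC; congr is_true; apply: eq_all => -[].
  by elim: (size vs) => //= k ->; rewrite count_nseq.
rewrite -(IH (fun q us => b q (v :: us))) -sumrN; apply: eq_bigr => m _.
rewrite al; case E: (mask m vs) => [|u [|u' us]];
  rewrite ?(mul0r, mulr0, oppr0) //.
(* Only masks selecting exactly one vector are left, so the leading false bit adds exactly one
   inversion. *)
have -> : count id m = 1%N by rewrite -(size_mask (s := vs)) ?size_tuple ?E.
by rewrite mul1n add1n exprS mulN1r mulNr.
Qed.

Lemma ext_dE (f : V -> K) p us :
  ext_d f p us = if us is [:: v] then 'd f p v else 0.
Proof. by []. Qed.

Lemma dlogE (f : V -> K) p us :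
  dlog f p us = if us is [:: v] then (f p)^-1 * 'd f p v else 0.
Proof. by case: us => [|u [|u' us]]; rewrite /dlog /scalef /= ?mulr0. Qed.

Lemma wedges_form1E (I : Type) (r : seq I) (a : I -> dform V)
    (l : I -> V -> K) p :
    (forall i us, a i p us = if us is [:: v] then l i v else 0) ->
  wedges (map a r) p = ewedges (map l r).
Proof.
move=> al; apply: funext; elim: r => [//|i r IH] vs /=.
by rewrite (wedge_form1E _ _ (al i)) (funext IH).
Qed.

Lemma foldr_contractE (I : Type) (X : I -> V -> V) (w : dform V) (r : seq I) p :
  foldr (fun i => Defs.contract (X i)) w r p = iprods (map (X^~ p) r) (w p).
Proof.
elim: r => [//|i r IH] /=; rewrite -IH.
by apply: funext.
Qed.

End WedgeForms.

(** * Differentials of linear maps, combinations and quotients *)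

Section Differentials.
Set Implicit Arguments.
Unset Strict Implicit.
Context {K : numFieldType} {W : normedModType K}.

Lemma is_diff_linear (W' : normedModType K) (f : W -> W') p :
  linear f -> continuous f -> is_diff p f f.
Proof.
move=> flin fcont.
pose F : {linear W -> W'} := HB.pack f (GRing.isLinear.Build _ _ _ _ f flin).
have Fcont : continuous F by [].
apply: DiffDef; first exact: (linear_differentiable p Fcont).
exact: (diff_lin p Fcont).
Qed.

Lemma is_diff_lincomb (I : eqType) (r : seq I) (c : I -> K)
    (f df : I -> W -> K) p :
    {in r, forall i, is_diff p (f i) (df i)} ->
  is_diff p (fun q => \sum_(i <- r) c i * f i q)
            (fun v => \sum_(i <- r) c i * df i v).
Proof.
elim: r => [|i r IH] dr.
  rewrite (_ : (fun q => _) = cst 0).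
    rewrite (_ : (fun v => _) = 0); first exact: is_diff_cst.
    by apply: funext => v; rewrite big_nil.
  by apply: funext => q; rewrite big_nil.
rewrite (_ : (fun q => _) =
    (c i *: f i) + (fun q => \sum_(k <- r) c k * f k q)); last first.
  by apply: funext => q; rewrite big_cons.
have di := dr i (mem_head _ _).
have dr' : {in r, forall k, is_diff p (f k) (df k)}.
  by move=> k kr; apply: dr; rewrite in_cons kr orbT.
have dr'' := IH dr'.
by apply: is_diff_eq; apply: funext => v; rewrite big_cons.
Qed.

Lemma is_diff_prod (f g df dg : W -> K) p :
    is_diff p f df -> is_diff p g dg ->
  is_diff p (fun q => f q * g q) (fun v => f p * dg v + g p * df v).
Proof. by move=> df' dg'; exact: is_diffM. Qed.

Lemma is_diff_ratio (f g df dg : W -> K) p :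
    g p != 0 -> is_diff p f df -> is_diff p g dg ->
  is_diff p (fun q => f q / g q)
    (fun v => f p * (- (g p) ^- 2 * dg v) + (g p)^-1 * df v).
Proof.
move=> g0 df' dg'; apply: is_diff_prod => //.
apply: DiffDef; first exact: differentiableV.
by rewrite diffV // diff_val.
Qed.

Lemma is_diff_dlog_ratio (f g df dg : W -> K) p v :
    f p != 0 -> g p != 0 -> is_diff p f df -> is_diff p g dg ->
  (f p / g p)^-1 * 'd (fun q => f q / g q) p v =
  (f p)^-1 * df v - (g p)^-1 * dg v.
Proof.
move=> f0 g0 df' dg'.
have -> : 'd (fun q => f q / g q) p v =
    f p * (- (g p) ^- 2 * dg v) + (g p)^-1 * df v.
  by have [_ ->] := is_diff_ratio g0 df' dg'.
by field; rewrite f0 g0.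
Qed.

End Differentials.

(** * Differentials on the chart and the final computation *)

Section ChartForms.
Set Implicit Arguments.
Unset Strict Implicit.
Context {K : numFieldType} {n : nat}.
Hypothesis n_ge3 : (3 <= n)%N.
Implicit Types (p v : chart K n).

Lemma entry_linear m k (c : K) (u w : 'rV[K]_m) :
  entry (c *: u + w) k = c * entry u k + entry w k.
Proof.
(* Out of range [entry] is the default 0, which is linear too. *)
rewrite /entry; case: insub => [i|] /=; last by rewrite mulr0 addr0.
by rewrite !mxE.
Qed.

Lemma entry_continuous m k : continuous (fun u : 'rV[K]_m => entry u k).
Proof.
rewrite /entry; case: insub => [i|] /= u; last exact: cst_continuous.
exact: coord_continuous.
Qed.

Lemma is_diff_z p i : (2 <= i)%N ->
  is_diff p (z i) (fun v => entry v.1 (i - 2)).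
Proof.
move=> i2; rewrite (_ : z i = fun q : chart K n => entry q.1 (i - 2)); last first.
  by apply: funext => q; rewrite /z gtn_eqF.
apply: is_diff_linear => [c u v|q]; first exact: (entry_linear _ c u.1 v.1).
exact: (continuous_comp cvg_fst (@entry_continuous _ _ _)).
Qed.

Lemma is_diff_zhat p i : (2 <= i < n)%N ->
  is_diff p (zhat i) (fun v => entry v.2 (i - 2)).
Proof.
case/andP=> i2 ltin.
rewrite (_ : zhat i = fun q : chart K n => entry q.2 (i - 2)); last first.
  by apply: funext => q; rewrite /zhat gtn_eqF // ltn_eqF.
apply: is_diff_linear => [c u v|q]; first exact: (entry_linear _ c u.2 v.2).
exact: (continuous_comp cvg_snd (@entry_continuous _ _ _)).
Qed.

Lemma zhat_n p : zhat n p = 1.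
Proof. by rewrite /zhat (gtn_eqF (ltnW n_ge3)) eqxx. Qed.

Lemma diff_zV p l i : (2 <= i <= n)%N ->
  'd (z i) p (V l p) = (l == i.-1)%:R * z i p.
Proof.
case/andP=> i2 lein; have [_ ->] := is_diff_z p i2.
have ik : (i - 2 < n - 1)%N by lia.
rewrite -[(i - 2)%N]/(val (Ordinal ik)) entryE mxE /= /z (gtn_eqF i2).
rewrite -[(i - 2)%N]/(val (Ordinal ik)) entryE.
by rewrite /weight_z /psi subnK // subn1; case: (l == i.-1).
Qed.

Lemma diff_zhatV p l i : (2 <= i < n)%N ->
  'd (zhat i) p (V l p) = ((l == n.-1)%:R - (l == i.-1)%:R) * zhat i p.
Proof.
move=> hi; have [_ ->] := is_diff_zhat p hi; case/andP: hi => i2 ltin.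
have ik : (i - 2 < n - 2)%N by lia.
rewrite -[(i - 2)%N]/(val (Ordinal ik)) entryE mxE /=.
rewrite /zhat (gtn_eqF i2) (ltn_eqF ltin).
rewrite -[(i - 2)%N]/(val (Ordinal ik)) entryE.
rewrite /weight_zhat /psi subnK // -!subn1 rmorphB.
by case: (l == (n - 1)%N); case: (l == (i - 1)%N).
Qed.

Lemma is_diff_A p i : (2 <= i < n)%N ->
  is_diff p (A i) (fun v => z i p * 'd (zhat i) p v + zhat i p * 'd (z i) p v).
Proof.
move=> hi; have [i2 _] := andP hi; apply: is_diff_prod.
  by have [dz _] := is_diff_z p i2; exact: DiffDef.
by have [dz _] := is_diff_zhat p hi; exact: DiffDef.
Qed.

Lemma A_n : A n = z n :> (chart K n -> K).
Proof. by apply: funext => p; rewrite /A zhat_n mulr1. Qed.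

Lemma differentiable_A_ge2 p i : (2 <= i <= n)%N -> differentiable (A i) p.
Proof.
case/andP=> i2; rewrite leq_eqVlt => /orP[/eqP->|ltin].
  by rewrite A_n; have [] := is_diff_z p (ltnW n_ge3).
by have hi : (2 <= i < n)%N; [rewrite i2 | have [] := is_diff_A p hi].
Qed.

Lemma A1E p : A 1 p = A 2 p - \sum_(3 <= k < n.+1) (-1) ^+ (k - 1) * A k p.
Proof. by rewrite /A (chart_on_X p (ltnW n_ge3)) addrK. Qed.

(** Since [zhat 1] is not a chart coordinate, [A 1] is differentiated through the equation of X. *)
Lemma is_diff_A1 p : is_diff p (A 1) (fun v => 'd (A 2) p v -
  \sum_(3 <= k < n.+1) (-1) ^+ (k - 1) * 'd (A k) p v).
Proof.
rewrite (_ : A 1 = A 2 -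
    (fun q => \sum_(3 <= k < n.+1) (-1) ^+ (k - 1) * A k q)); last first.
  by apply: funext => q; rewrite A1E.
have d2 : is_diff p (A 2) ('d (A 2) p).
  by apply: differentiableP; apply: differentiable_A_ge2; rewrite leqnn ltnW.
apply: is_diffB.
apply: is_diff_lincomb => k; rewrite mem_index_iota => /andP[k3 kn].
by apply: differentiableP; apply: differentiable_A_ge2; rewrite ltnW.
Qed.

Lemma is_diff_B p k : (2 <= k)%N -> is_diff p (B k) (fun v =>
  \sum_(k <= i < n.+1) (-1) ^+ (i - k) * 'd (A i) p v).
Proof.
move=> k2; apply: is_diff_lincomb => i; rewrite mem_index_iota => /andP[ki lein].
by apply: differentiableP; apply: differentiable_A_ge2; rewrite (leq_trans k2).
Qed.

(** With respect to V_(n-1), z_i has weight 0 and z_^i weight 1 when i < n, while A_n = z_n has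
    weight 1; so each product has weight 1. *)
Lemma diff_A_euler_ge2 p i : (2 <= i <= n)%N -> 'd (A i) p (V n.-1 p) = A i p.
Proof.
case/andP=> i2 lein; move: (lein); rewrite leq_eqVlt => /orP[/eqP->|ltin].
  by rewrite A_n diff_zV ?leqnn ?(ltnW n_ge3) // eqxx mul1r.
have hi : (2 <= i < n)%N by rewrite i2.
have [_ ->] := is_diff_A p hi.
rewrite diff_zV ?i2 // diff_zhatV ?i2 // eqxx gtn_eqF /=; last by lia.
by rewrite /A; ring.
Qed.

Lemma diff_A1_euler p : 'd (A 1) p (V n.-1 p) = A 1 p.
Proof.
have [_ ->] := is_diff_A1 p.
rewrite A1E diff_A_euler_ge2 ?leqnn ?(ltnW n_ge3) //; congr (_ - _).
apply: eq_big_nat => k /andP[k3 kn].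
by rewrite diff_A_euler_ge2 // (ltnW k3).
Qed.

Lemma diff_B_euler p k : (2 <= k)%N -> 'd (B k) p (V n.-1 p) = B k p.
Proof.
move=> k2; have [_ ->] := is_diff_B p k2.
apply: eq_big_nat => i /andP[ki lein].
by rewrite diff_A_euler_ge2 // (leq_trans k2).
Qed.

Lemma diff_AE p i v : (2 <= i < n)%N ->
  'd (A i) p v = z i p * 'd (zhat i) p v + zhat i p * 'd (z i) p v.
Proof. by move=> hi; case: (is_diff_A p hi) => _ /(congr1 (fun f => f v)). Qed.

Lemma diff_A1E p v : 'd (A 1) p v =
  'd (A 2) p v - \sum_(3 <= k < n.+1) (-1) ^+ (k - 1) * 'd (A k) p v.
Proof. by case: (is_diff_A1 p) => _ /(congr1 (fun f => f v)). Qed.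

Lemma diff_BE p k v : (2 <= k)%N ->
  'd (B k) p v = \sum_(k <= i < n.+1) (-1) ^+ (i - k) * 'd (A i) p v.
Proof. by move=> k2; case: (is_diff_B p k2) => _ /(congr1 (fun f => f v)). Qed.

Lemma OmegaE p : Omega p = ewedges (flatten
    [seq [:: ('d (z i) p : chart K n -> K); ('d (zhat i) p : chart K n -> K)]
      | i <- index_iota 2 n] ++ [:: ('d (z n) p : chart K n -> K)]).
Proof.
rewrite -(map_flatten_pairs
  (fun f : chart K n -> K => 'd f p : chart K n -> K)).
rewrite -(wedges_form1E _ (fun f us => ext_dE f p us)).
by rewrite (map_flatten_pairs ext_d).
Qed.

Lemma dlog_formE p j : (3 <= j <= n)%N -> regular_at j p ->
  dlog_form j p = ewedges (
    (fun v => (A 1 p)^-1 * 'd (A 1) p v - (B j p)^-1 * 'd (B j) p v) ::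
    [seq (fun v => (A i p)^-1 * 'd (A i) p v - (B j p)^-1 * 'd (B j) p v)
      | i <- index_iota 3 j] ++
    [seq (fun v => (B k p)^-1 * 'd (B k) p v - (B j p)^-1 * 'd (B j) p v)
      | k <- index_iota j.+1 n.+1]).
Proof.
move=> /andP[j3 lejn] [A10 A0 B0].
have Bj0 : B j p != 0 by apply: B0; rewrite leqnn.
have dB k : (2 <= k)%N -> is_diff p (B k) ('d (B k) p).
  by move=> k2; apply: differentiableP; case: (is_diff_B p k2).
have dA i : (2 <= i <= n)%N -> is_diff p (A i) ('d (A i) p).
  by move=> hi; apply: differentiableP; exact: differentiable_A_ge2.
have dA1 : is_diff p (A 1) ('d (A 1) p).
  by apply: differentiableP; case: (is_diff_A1 p).
have dBj := dB j (ltnW j3).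
rewrite /dlog_form -(map_cons_cat dlog).
rewrite (wedges_form1E _ (fun f us => dlogE f p us)) map_cons_cat.
congr (ewedges (_ :: _ ++ _)).
- by apply: funext => v; exact: (is_diff_dlog_ratio v A10 Bj0 dA1 dBj).
- apply/eq_in_map => i; rewrite mem_index_iota => hi; have /andP[i3 ltij] := hi.
  have hi' : (2 <= i <= n)%N by rewrite (ltnW i3) (leq_trans (ltnW ltij)).
  apply: funext => v.
  exact: (is_diff_dlog_ratio v (A0 i hi) Bj0 (dA i hi') dBj).
- apply/eq_in_map => k; rewrite mem_index_iota => /andP[ltjk lekn].
  have k2 : (2 <= k)%N by rewrite (leq_trans (ltnW j3)) // ltnW.
  have Bk0 : B k p != 0 by apply: B0; rewrite (ltnW ltjk).
  by apply: funext => v; exact: (is_diff_dlog_ratio v Bk0 Bj0 (dB k k2) dBj).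
Qed.

Lemma contract_all_OmegaX p j : (3 <= j <= n)%N -> regular_at j p ->
  contract_all (OmegaX j) p =
  scalef (fun=> (-1) ^+ (n - j)) (dlog_form j) p.
Proof.
move=> hj preg; have [j3 lejn] := andP hj; have [A10 A0 B0] := preg.
pose x i : chart K n -> K := 'd (z i) p.
pose y i : chart K n -> K := 'd (zhat i) p.
pose a i : chart K n -> K := 'd (A i) p.
pose b k : chart K n -> K := 'd (B k) p.
have an : a n = x n by rewrite /a A_n.
have flag := @iprods_flag _ K n x y a (fun l => V l p) (fun i => z i p)
  (fun i => zhat i p) n_ge3 (@diff_zV p) (@diff_zhatV p) (@diff_AE p) an.
have AB := @ewedges_AB _ K n j a b hj (@diff_A1E p)
  (fun k v k3 => @diff_BE p k v (ltnW k3)).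
have aE i : (3 <= i < j)%N -> a i (V n.-1 p) = A i p.
  case/andP=> i3 ltij; apply: diff_A_euler_ge2.
  by rewrite ltnW // ltnW // (leq_trans ltij).
have bE k : (j <= k <= n)%N -> b k (V n.-1 p) = B k p.
  by case/andP=> jk _; apply: diff_B_euler; exact: leq_trans (ltnW j3) jk.
apply: funext => vs.
have ratio := @iprod_ewedges_AB _ K n j a b (fun i => A i p) (fun k => B k p)
  (V n.-1 p) vs hj A10 A0 B0 (diff_A1_euler p) aE bE.
(* Contraction is evaluation on a longer list, so the scalar factor leaves all contractions at
   once. *)
rewrite /contract_all foldr_contractE iprodsE /OmegaX /scalef -iprodsE OmegaE.
rewrite (dlog_formE hj preg).
have -> : index_iota 1 n = rcons (index_iota 1 n.-1) n.-1.
  rewrite /index_iota -cats1 (_ : n - 1 = n.-1 - 1 + 1)%N; last by lia.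
  by rewrite iotaD subnKC //; lia.
rewrite map_rcons iprods_rcons; last exact: alternating_ewedges.
rewrite -/x -/y flag AB ratio size_map size_iota.
set C := A 1 p * _ * _.
have C0 : C != 0.
  have prod_neq0 m1 m2 (F : nat -> K) :
      (forall i, (m1 <= i < m2)%N -> F i != 0) -> \prod_(m1 <= i < m2) F i != 0.
    move=> F0; rewrite big_seq prodf_seq_neq0; apply/allP => i _.
    by apply/implyP; rewrite mem_index_iota; exact: F0.
  by apply: mulf_neq0; [apply: mulf_neq0 => // |]; exact: prod_neq0.
(* The exponents n - j and (n - 2) + j differ by the even number 2(j - 1). *)
have -> : (-1) ^+ (n - j) = (-1) ^+ (n.-1 - 1) * (-1) ^+ j :> K.
  rewrite -exprD -[in RHS](subnKC lejn).
  rewrite (_ : (j + (n - j)).-1 - 1 + j = (n - j) + 2 * (j - 1))%N; last by lia.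
  by rewrite exprD exprM sqrrN !expr1n mulr1.
(* With its body cleared, [C] is an atom that cancels by [C0]. *)
by clearbody C; field.
Qed.

End ChartForms.

Theorem proposition3p4 (R : realType) (n : nat) (n_ge3 : (3 <= n)%N)
    (j : nat) (j_bounds : (3 <= j <= n)%N)
    (p : chart R[i] n) (p_regular : regular_at j p) :
  contract_all (OmegaX j) p =
  scalef (fun=> (-1) ^+ (n - j)) (dlog_form j) p.
Proof. exact: contract_all_OmegaX. Qed.
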